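(* Let $n\ge1$. For any integer $K\ge 1$ and any $\alpha>0$ there exist closed convex proper functions $f,g:\mathbb{R}^n\to\mathbb{R}\cup\{+\infty\}$, for which there are $x^\star,u^\star\in\mathbb{R}^n$ with $0\in\partial f(x^\star)+u^\star$ and $0\in\partial g^*(u^\star)-x^\star$, and points $x^0,u^0\in\mathbb{R}^n$, $x\in\mathrm{dom}\, f$, $u\in\mathrm{dom}\, g^*$ such that $\|x^0-x\|^2+\alpha^2\|u^0-u\|^2=1$ and $$\mathcal{L}(\bar x^K,u)-\mathcal{L}(x,\bar u^K)=\frac{1}{\alpha(K+1)}\left(\|x^0-x\|^2+\alpha^2\|u^0-u\|^2\right),$$ where $\bar x^K=\frac1K\sum_{k=1}^K x^k$, $\bar u^K=\frac1K\sum_{k=1}^K u^k$, and $\{(x^k,u^k)\}_{k\ge0}$ is generated from $(x^0,u^0)$ by $$x^{k+1}=\mathrm{prox}_{\alpha f}\big(x^k-\alpha u^k\big),\qquad u^{k+1}=\mathrm{prox}_{\alpha^{-1}g^*}\big(u^k+\tfrac1\alpha(2x^{k+1}-x^k)\big),\qquad k=0,1,2,\dots$$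
   Context: $\langle\cdot,\cdot\rangle$ and $\|\cdot\|$ are the standard inner product and Euclidean norm on $\mathbb{R}^n$. $g^*(y)=\sup_x\{\langle y,x\rangle-g(x)\}$ is the Fenchel conjugate, $\partial$ the convex subdifferential, and $\mathrm{prox}_\varphi(x)=\arg\min_{y}\{\varphi(y)+\frac12\|y-x\|^2\}$. The Lagrangian is $\mathcal{L}(x,u)=f(x)+\langle u,x\rangle-g^*(u)$. The iteration is the swapped Douglas--Rachford splitting algorithm (variant DRS-$fg$) for minimizing $f+g$. *)

(* Defs.v *)
From HB Require Import structures.
From mathcomp Require Import all_boot all_order all_algebra.
From mathcomp Require Import all_classical all_reals all_analysis.

Set Implicit Arguments.
Unset Strict Implicit.
Unset Printing Implicit Defensive.

Import Order.TTheory GRing.Theory Num.Theory.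
Import numFieldNormedType.Exports.

Local Open Scope classical_set_scope.
Local Open Scope ring_scope.

Section ConvexAnalysis.
Context {R : realType} {n : nat}.
Implicit Types (f g phi : 'rV[R]_n -> \bar R) (x y u v p : 'rV[R]_n).

Definition dot x y : R := \sum_(i < n) x ord0 i * y ord0 i.

(* The library norm `|x| on row vectors is the sup norm; it induces the same
   topology as the Euclidean norm below, so only the topology is used from it. *)
Definition enorm x : R := Num.sqrt (dot x x).

Definition effdom f : set 'rV[R]_n := [set x | (f x < +oo)%E].

Definition epigraph f : set ('rV[R]_n * R) := [set p | (f p.1 <= p.2%:E)%E].

(* Since \bar R also contains -oo, properness includes never taking the value
   -oo, i.e. f maps into R `|` [set +oo]. *)
Definition proper_efun f : Prop := (forall x, f x <> -oo%E) /\ effdom f !=set0.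

Definition convex_efun f : Prop :=
  forall x y (t : R), 0 < t -> t < 1 ->
    (f (t *: x + (1 - t) *: y)%R
       <= t%:E * f x + (1 - t)%:E * f y)%E.

Definition closed_convex_proper f : Prop :=
  [/\ closed (epigraph f), convex_efun f & proper_efun f].

Definition fenchel_conj g : 'rV[R]_n -> \bar R :=
  fun y => ereal_sup [set ((dot y x)%:E - g x)%E | x in [set: 'rV[R]_n]].

(* Empty outside effdom f when f is proper. *)
Definition subdifferential f x : set 'rV[R]_n :=
  [set v | forall z, (f x + (dot v (z - x)%R)%:E <= f z)%E].

Definition argmin phi : set 'rV[R]_n :=
  [set y | forall z, (phi y <= phi z)%E].

(* p = prox_phi(x): p is the minimizer, and the only one. *)
Definition is_prox phi x p : Prop :=
  argmin (fun y => (phi y + (2^-1 * enorm (y - x)%R ^+ 2)%:E)%E) = [set p].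

Definition Lagrangian f g x u : \bar R :=
  (f x + (dot u x)%:E - fenchel_conj g u)%E.

Definition drs_fg f g (alpha : R) (X U : nat -> 'rV[R]_n) : Prop :=
  forall k,
    is_prox (fun y => (alpha%:E * f y)%E) (X k - alpha *: U k) (X k.+1) /\
    is_prox (fun y => ((alpha^-1)%:E * fenchel_conj g y)%E)
            (U k + alpha^-1 *: (2 *: X k.+1 - X k)) (U k.+1).

Definition ergodic (X : nat -> 'rV[R]_n) (K : nat) : 'rV[R]_n :=
  (K%:R)^-1 *: \sum_(1 <= k < K.+1) X k.

End ConvexAnalysis.

(* Main.v *)
Require Import Defs.
From HB Require Import structures.
From mathcomp Require Import all_boot all_order all_algebra.
From mathcomp Require Import all_classical all_reals all_analysis.
From mathcomp Require Import ring zify.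

Set Implicit Arguments.
Unset Strict Implicit.
Unset Printing Implicit Defensive.

Import Order.TTheory GRing.Theory Num.Theory.
Import numFieldNormedType.Exports.

Local Open Scope classical_set_scope.
Local Open Scope ring_scope.

(** The idea: take [g = 0], so that its conjugate is the indicator of the origin
    and every dual iterate after the initial one vanishes.  From then on the
    iteration is the proximal point method for [f], and for the latter the
    slowest objective is an absolute value (here of one coordinate [j]):
    each step moves towards the minimizer by a constant length.

    Put [d = alpha * c] where [f y = c * |y_j|].  The first primal step only
    sees [x0 - alpha *: u0], so for a fixed size of the initial error the best
    choice is to align both parts, [x0 = s *: e_j] and [alpha *: u0 = - s *: e_j]
    with [s ^ 2 = 1/2].  The orbit then behaves as if it started at distance
    [2 * s] from the origin, and it loses [d] at each step.  With [x = u = 0] the gap is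
    [f] at the averaged iterate, that is [c * (2 * s - d * (K + 1) / 2)].  It is
    largest for [d = 2 * s / (K + 1)]: the iterates reach the origin
    exactly one step after the averaging window, and the gap equals
    [2 * s ^ 2 / (alpha * (K + 1))], which is the bound.

    [is_prox_subgradient] certifies all the proximal steps;
    [fenchel_conj_cst0] computes the conjugate; [sum_countdown] evaluates the
    averages of the iterates. *)

Section EuclideanSpace.
Context {R : realType} {n : nat}.
Implicit Types (x y z : 'rV[R]_n) (a b : R) (j : 'I_n).

Lemma dotDl x y z : dot (x + y) z = dot x z + dot y z.
Proof.
by rewrite /dot -big_split; apply: eq_bigr => i _; rewrite mxE mulrDl.
Qed.

Lemma dotZl a x y : dot (a *: x) y = a * dot x y.
Proof. by rewrite /dot mulr_sumr; apply: eq_bigr => i _; rewrite mxE mulrA. Qed.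

Lemma dotC x y : dot x y = dot y x.
Proof. by apply: eq_bigr => i _; rewrite mulrC. Qed.

Lemma dotDr x y z : dot x (y + z) = dot x y + dot x z.
Proof. by rewrite dotC dotDl !(dotC x). Qed.

Lemma dotZr a x y : dot x (a *: y) = a * dot x y.
Proof. by rewrite dotC dotZl dotC. Qed.

Lemma dot0l x : dot 0 x = 0.
Proof. by rewrite -[0](scale0r (0 : 'rV[R]_n)) dotZl mul0r. Qed.

Lemma dot0r x : dot x 0 = 0.
Proof. by rewrite dotC dot0l. Qed.

Lemma dot_ge0 x : 0 <= dot x x.
Proof. by apply: sumr_ge0 => i _; rewrite -expr2 sqr_ge0. Qed.

Lemma dot_eq0 x : (dot x x == 0) = (x == 0).
Proof.
apply/eqP/eqP => [xx0|->]; last exact: dot0l.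
apply/rowP => i; rewrite mxE; apply/eqP; rewrite -sqrf_eq0 expr2.
move/psumr_eq0P: xx0 => -> // k _; by rewrite -expr2 sqr_ge0.
Qed.

Lemma enorm_sqr x : enorm x ^+ 2 = dot x x.
Proof. by rewrite /enorm sqr_sqrtr ?dot_ge0. Qed.

Lemma dot_delta j y : dot (delta_mx ord0 j) y = y ord0 j.
Proof.
rewrite /dot (bigD1 j) //= big1 => [|i ij]; rewrite mxE eqxx /=.
  by rewrite eqxx mul1r addr0.
by rewrite (negbTE ij) mul0r.
Qed.

Lemma enorm_scale_delta a j : enorm (a *: delta_mx ord0 j) ^+ 2 = a ^+ 2.
Proof.
by rewrite enorm_sqr dotZl dotZr dot_delta mxE !eqxx mulr1 expr2.
Qed.

Lemma enorm_sqrD x y : enorm (x + y) ^+ 2 =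
  enorm x ^+ 2 + 2 * dot x y + enorm y ^+ 2.
Proof. by rewrite !enorm_sqr dotDl !dotDr (dotC y x); ring. Qed.

End EuclideanSpace.

Section ConvexFunctions.
Context {R : realType} {n : nat}.
Implicit Types (x y p u : 'rV[R]_n) (phi : 'rV[R]_n -> \bar R).

(** The optimality condition of the proximal problem.  A subgradient inequality
    with slope [x - p], completed to a square, bounds the proximal objective at
    [z] below by its value at [p] plus [|z - p| ^ 2 / 2]; the extra square
    gives uniqueness. *)
Lemma is_prox_subgradient phi x p (r : R) :
  phi p = r%:E -> subdifferential phi p (x - p) -> is_prox phi x p.
Proof.
move=> phip sub.
have growth z : ((r + 2^-1 * enorm (p - x) ^+ 2 + 2^-1 * enorm (z - p) ^+ 2)%:E
    <= phi z + (2^-1 * enorm (z - x) ^+ 2)%:E)%E.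
  have -> : r + 2^-1 * enorm (p - x) ^+ 2 + 2^-1 * enorm (z - p) ^+ 2 =
      r + dot (x - p) (z - p) + 2^-1 * enorm (z - x) ^+ 2.
    have -> : z - x = (z - p) + (p - x) by rewrite addrA subrK.
    have -> : x - p = -1 *: (p - x) by rewrite scaleN1r opprB.
    by rewrite (enorm_sqrD (z - p)) dotZl (dotC (p - x)); field.
  by rewrite EFinD leeD2r// EFinD -phip; exact: sub.
rewrite /is_prox; apply/seteqP; split => [q /= /(_ p)|q /= -> z]; rewrite phip.
  move=> /(le_trans (growth q)); rewrite -EFinD lee_fin gerDl pmulr_rle0//.
  rewrite enorm_sqr => qp_le0; apply/eqP; rewrite -subr_eq0 -dot_eq0.
  by rewrite eq_le qp_le0 dot_ge0.
apply: le_trans (growth z); rewrite -EFinD lee_fin lerDl mulr_ge0//.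
by rewrite sqr_ge0.
Qed.

Lemma closed_convex_proper_real (h : 'rV[R]_n -> R) :
  continuous h ->
  (forall x y t, 0 < t -> t < 1 ->
     h (t *: x + (1 - t) *: y) <= t * h x + (1 - t) * h y) ->
  closed_convex_proper (fun x => (h x)%:E).
Proof.
move=> ch hconv; split.
- rewrite /epigraph.
  have -> : [set p : 'rV[R]_n * R | ((h p.1)%:E <= p.2%:E)%E] =
      (fun p : 'rV[R]_n * R => p.2 - h p.1) @^-1` [set a | 0 <= a].
    by apply/seteqP; split => p /=; rewrite lee_fin subr_ge0.
  apply: closed_comp; last exact: closed_ge.
  move=> p _; apply: cvgB; first exact: cvg_snd.
  by apply: continuous_comp; [exact: cvg_fst|exact: ch].
- by move=> x y t t0 t1; rewrite -!EFinM -EFinD lee_fin hconv.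
- by split=> //; exists 0; rewrite /effdom /= ltry.
Qed.

(** The conjugate of [0] is the support function of the whole space: in a
    direction [u != 0] the linear form takes the value [a] at
    [(a / |u| ^ 2) *: u], for every [a]. *)
Lemma fenchel_conj_cst0 u :
  fenchel_conj (fun=> 0%:E) u = if u == 0 then 0%E else +oo%E.
Proof.
case: eqP => [->|/eqP u0].
  rewrite /fenchel_conj (_ : [set _ | _ in _] = [set 0%E]) ?ereal_sup1//.
  apply/seteqP; split => [_ [x _ <-]|_ /= ->]; first by rewrite dot0l sube0.
  by exists 0; rewrite // dot0l sube0.
apply: eq_infty => a.
apply: ereal_sup_ubound; exists ((a / dot u u) *: u) => //.
by rewrite sube0 dotZr mulfVK// dot_eq0.
Qed.

(** The conjugate of [0] being the indicator of the origin, its subdifferential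
    there is the whole space, whence a constant proximal map. *)
Lemma subdifferential_conj_cst0 (w : 'rV[R]_n) (r : R) : 0 < r ->
  subdifferential (fun y => (r%:E * fenchel_conj (fun=> 0%:E) y)%E) 0 w.
Proof.
move=> r_gt0 z; rewrite !fenchel_conj_cst0 eqxx mule0 add0e subr0.
by case: eqP => [->|_]; rewrite ?dot0r ?mule0// gt0_muley ?lte_fin// leey.
Qed.

End ConvexFunctions.

Section CoordinateAbs.
Context {R : realType} {n : nat}.
Implicit Types (c a b m : R) (j : 'I_n) (y : 'rV[R]_n).

Definition coord_abs c j y : \bar R := (c * `|y ord0 j|)%:E.

Lemma coord_abs_closed_convex_proper c j :
  0 <= c -> closed_convex_proper (coord_abs c j).
Proof.
move=> c0; apply: (@closed_convex_proper_real _ _ (fun y => c * `|y ord0 j|)).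
  move=> y; apply: (continuous_comp (g := fun a => c * `|a|)).
    exact: coord_continuous.
  by apply: cvgM; [exact: cvg_cst|apply: cvg_norm; exact: cvg_id].
move=> x y t t0 t1; rewrite !mxE mulrCA (mulrCA (1 - t)) -mulrDr ler_wpM2l//.
rewrite (le_trans (ler_normD _ _))// !normrM (gtr0_norm t0).
by rewrite (@gtr0_norm _ (1 - t)) ?subr_gt0.
Qed.

(** The proximal map of an absolute value is soft thresholding, here in the
    only two cases in which the orbit meets it. *)
Lemma coord_abs_prox c alpha j b m : 0 <= c -> 0 < alpha ->
  (0 <= m /\ b = m + alpha * c) \/ (m = 0 /\ b = 0) ->
  is_prox (fun y => (alpha%:E * coord_abs c j y)%E)
    (b *: delta_mx ord0 j) (m *: delta_mx ord0 j).
Proof.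
move=> c0 a0 bm; apply: is_prox_subgradient; first by rewrite -EFinM.
move=> z; rewrite /coord_abs -!EFinM -EFinD lee_fin -scalerBl dotZl dot_delta.
rewrite !mxE !eqxx mulr1.
have ac0 : 0 <= alpha * c by rewrite mulr_ge0// ltW.
case: bm => -[]; last by move=> -> ->; rewrite subrr mul0r normr0 !mulr0 addr0
  mulrA mulr_ge0.
move=> m0 ->; rewrite (ger0_norm m0) addrAC subrr add0r !mulrA -mulrDr subrKC.
by rewrite ler_wpM2l// ler_norm.
Qed.

End CoordinateAbs.

Lemma sum_countdown (K : nat) :
  ((\sum_(1 <= k < K.+1) (K.+1 - k)) * 2 = K * K.+1)%N.
Proof.
rewrite big_nat_rev /= big_add1 /=.
under eq_big_nat => k /andP[_ kK].
  rewrite (_ : (_ - _ = k.+1)%N); last lia.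
over.
elim: K => [|K IH]; first by rewrite big_geq.
by rewrite big_nat_recr//= mulnDl IH; lia.
Qed.

Theorem theorem3p8 (R : realType) (n : nat) (n_ge1 : (1 <= n)%N)
    (K : nat) (K_ge1 : (1 <= K)%N) (alpha : R) (alpha_gt0 : 0 < alpha) :
  exists f g : 'rV[R]_n -> \bar R,
    [/\ closed_convex_proper f,
        closed_convex_proper g,
        exists xstar ustar : 'rV[R]_n,
          [set v + ustar | v in subdifferential f xstar] 0 /\
          [set w - xstar | w in subdifferential (fenchel_conj g) ustar] 0
      & exists x0 u0 x u : 'rV[R]_n,
          [/\ effdom f x,
              effdom (fenchel_conj g) u,
              enorm (x0 - x) ^+ 2 + alpha ^+ 2 * enorm (u0 - u) ^+ 2 = 1
            & exists X U : nat -> 'rV[R]_n,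
                [/\ X 0%N = x0,
                    U 0%N = u0,
                    drs_fg f g alpha X U
                  & (Lagrangian f g (ergodic X K) u
                       - Lagrangian f g x (ergodic U K))%E
                    = ((alpha * (K%:R + 1))^-1
                        * (enorm (x0 - x) ^+ 2
                             + alpha ^+ 2 * enorm (u0 - u) ^+ 2))%:E]]].
Proof.
pose j := Ordinal n_ge1; pose e : 'rV[R]_n := delta_mx ord0 j.
pose s : R := Num.sqrt 2^-1.
have s2 : s ^+ 2 = 2^-1 by rewrite sqr_sqrtr// invr_ge0.
have K1_neq0 : K%:R + 1 != 0 :> R by rewrite natr1 pnatr_eq0.
have K_neq0 : K%:R != 0 :> R by rewrite pnatr_eq0 -lt0n.
have alpha_neq0 : alpha != 0 by rewrite gt_eqF.
pose d : R := 2 * s / (K%:R + 1); pose c : R := d / alpha.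
have d_ge0 : 0 <= d by rewrite divr_ge0// ?mulr_ge0 ?sqrtr_ge0// natr1.
have c_ge0 : 0 <= c by rewrite divr_ge0// ltW.
have alphac : alpha * c = d by rewrite mulrC divfK.
exists (coord_abs c j), (fun=> 0%:E); split.
- exact: coord_abs_closed_convex_proper.
- apply: closed_convex_proper_real => [|x y t _ _]; first exact: cst_continuous.
  by rewrite !mulr0 addr0.
- exists 0, 0; split; exists 0; rewrite ?addr0 ?subr0//.
    move=> z; rewrite dot0l adde0 lee_fin mxE normr0 mulr0.
    by rewrite mulr_ge0.
  move=> z; have /(_ z) := @subdifferential_conj_cst0 R n 0 1 ltr01.
  by rewrite !mul1e.
(* The truncated subtraction makes the orbit rest at the origin once it has
   arrived there. *)
pose X k : 'rV[R]_n := if k is 0%N then s *: e else ((K.+1 - k)%:R * d) *: e.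
pose U k : 'rV[R]_n := if k is 0%N then (- (s / alpha)) *: e else 0.
have unit_error :
    enorm (X 0%N - 0) ^+ 2 + alpha ^+ 2 * enorm (U 0%N - 0) ^+ 2 = 1.
  by rewrite !subr0 !enorm_scale_delta sqrrN expr_div_n s2; field.
exists (X 0%N), (U 0%N), 0, 0; split.
- by rewrite /effdom /= ltry.
- by rewrite /effdom /= fenchel_conj_cst0 eqxx ltry.
- exact: unit_error.
rewrite unit_error; exists X, U; split => //.
- move=> k; split; last first.
    apply: (@is_prox_subgradient _ _ _ _ _ 0).
      by rewrite /= fenchel_conj_cst0 eqxx mule0.
    by apply: subdifferential_conj_cst0; rewrite invr_gt0.
  have -> : X k - alpha *: U k = ((K.+1 - k)%:R * d) *: e.
    case: k => [|k] /=; last by rewrite scaler0 subr0.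
    rewrite scalerA -scalerBl subn0 -natr1 /d.
    by congr (_ *: _); field; rewrite K1_neq0.
  apply: coord_abs_prox => //; rewrite alphac subSS.
  have [kK|Kk] := leqP k K.
    left; split; first by rewrite mulr_ge0.
    by rewrite subSn// -natr1 mulrDl mul1r.
  right; have /eqP -> : (K - k == 0)%N by rewrite subn_eq0 ltnW.
  by have /eqP -> : (K.+1 - k == 0)%N by []; rewrite mul0r.
- have -> : ergodic U K = 0.
    rewrite /ergodic big_nat big1 ?scaler0// => -[|k] //.
  have -> : ergodic X K = ((K%:R + 1) / 2 * d) *: e.
    rewrite /ergodic (eq_big_nat _ _ (F2 := fun k => ((K.+1 - k)%:R * d) *: e)).
      rewrite -scaler_suml -mulr_suml -natr_sum scalerA; congr (_ *: _).
      rewrite mulrA; congr (_ * _).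
      apply: (mulIf (_ : 2 != 0)); first by rewrite pnatr_eq0.
      by rewrite -mulrA -natrM sum_countdown natrM -natr1; field.
    by case.
  rewrite /Lagrangian fenchel_conj_cst0 eqxx !dot0l !sube0 !adde0.
  rewrite /coord_abs !mxE !eqxx normr0 mulr0 sube0 mulr1; congr (_%:E).
  rewrite ger0_norm; last by rewrite mulr_ge0// divr_ge0// natr1.
  have -> : c * ((K%:R + 1) / 2 * d) = 2 * s ^+ 2 / (alpha * (K%:R + 1)).
    by rewrite /c /d; field; rewrite K1_neq0.
  by rewrite s2 mulfV// mul1r mulr1.
Qed.
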